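(* Let $\mathcal{A}\in\mathbb{C}^{N\times N}$, $\mathcal{B}\in\mathbb{C}^{N\times P}$, $\mathcal{C}\in\mathbb{C}^{Q\times N}$ be matrices and let $\|\cdot\|$ denote the matrix norm induced by the vector $p$-norm for a fixed $p\in[1,\infty]$. Then $$\sup_{t\ge 0}\|\mathcal{C}e^{t\mathcal{A}}\mathcal{B}\|\;\ge\;\sup_{\operatorname{Re} s>0}\operatorname{Re}(s)\,\|\mathcal{C}(sI-\mathcal{A})^{-1}\mathcal{B}\|,$$ where the suprema are taken in $[0,\infty]$ and the second one is over all $s\in\mathbb{C}$ with $\operatorname{Re} s>0$.
   Context: The vector $p$-norms are $\|x\|_p=(\sum_k|x_k|^p)^{1/p}$ for $1\le p<\infty$ and $\|x\|_\infty=\max_k|x_k|$; the induced matrix norm is $\|M\|=\sup_{\|x\|_p=1}\|Mx\|_p$ (same $p$ on domain and codomain). The transfer matrix $\mathcal{C}(sI-\mathcal{A})^{-1}\mathcal{B}$ is regarded as a matrix of rational functions of $s\in\mathbb{C}$ (so removable singularities at eigenvalues of $\mathcal{A}$ are removed); at a pole its norm is taken to be $+\infty$. *)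

(* Defs.v *)
From HB Require Import structures.
From mathcomp Require Import all_boot all_order all_algebra fraction.
From mathcomp Require Import complex.
From mathcomp Require Import all_classical all_reals all_analysis.

Set Implicit Arguments.
Unset Strict Implicit.
Unset Printing Implicit Defensive.

Import Order.TTheory GRing.Theory Num.Theory.
Import numFieldNormedType.Exports.

Local Open Scope classical_set_scope.
Local Open Scope ring_scope.

(* The finite exponents are r with 1 <= r; the value at -oo is a dummy. *)
Definition pnorm (R : realType) (p : \bar R) (n : nat) (x : 'cV[R[i]]_n) : R :=
  match p with
  | r%:E => (\sum_(k < n) Normc.normc (x k 0) `^ r) `^ r^-1
  | +oo%E => \big[Num.max/0]_(k < n) Normc.normc (x k 0)
  | -oo%E => 0
  end.

(* The supremum is taken in [0, +oo]: adjoining 0 only matters when n = 0,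
   where there is no unit vector. *)
Definition opnorm (R : realType) (p : \bar R) (m n : nat) (M : 'M[R[i]]_(m, n)) :
    \bar R :=
  ereal_sup (0%E |` [set (pnorm p (M *m x))%:E | x in [set x | pnorm p x = 1]]).

(* The limit is taken in the topology of matrices over R[i]^o, i.e. R[i] with
   the topology of its modulus. *)
Definition expmx (R : realType) (n : nat) (M : 'M[R[i]]_n) : 'M[R[i]]_n :=
  lim (series (fun k => (k`!%:R^-1 *: M ^+ k : 'M[R[i]^o]_n)) @ \oo).

Definition fracC (K : fieldType) (a : K) : {fraction {poly K}} :=
  tofrac (a%:P).

(* char_poly_mx A is the polynomial matrix 'X%:M - A; it is inverted over the
   field of rational functions. *)
Definition transfer_mx (K : fieldType) (N P Q : nat)
    (A : 'M[K]_N) (B : 'M[K]_(N, P)) (C : 'M[K]_(Q, N)) :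
    'M[{fraction {poly K}}]_(Q, P) :=
  map_mx (@fracC K) C *m invmx (map_mx (@tofrac _) (char_poly_mx A))
    *m map_mx (@fracC K) B.

(* f takes the finite value v at s; for a pole s of f there is no such v. *)
Definition frac_value (K : fieldType) (f : {fraction {poly K}}) (s v : K) : Prop :=
  exists n d : {poly K},
    [/\ d.[s] != 0, f = tofrac n / tofrac d & v = n.[s] / d.[s]].

Definition mx_frac_value (K : fieldType) (m n : nat)
    (F : 'M[{fraction {poly K}}]_(m, n)) (s : K) (M : 'M[K]_(m, n)) : Prop :=
  forall i j, frac_value (F i j) s (M i j).

Lemma frac_value_uniq (K : fieldType) (f : {fraction {poly K}}) (s v w : K) :
  frac_value f s v -> frac_value f s w -> v = w.
Proof.
have nz (d : {poly K}) : d.[s] != 0 -> tofrac d != 0.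
  by rewrite tofrac_eq0; apply: contraNneq => ->; rewrite horner0.
move=> [n [d [ds -> ->]]] [n' [d' [ds' + ->]]].
move/eqP; rewrite eqr_div ?nz// -!tofracM tofrac_eq => /eqP/(congr1 (horner^~ s)).
by rewrite /= !hornerM => e; apply/eqP; rewrite eqr_div//; apply/eqP.
Qed.

(* By frac_value_uniq the choice of the matrix does not matter. *)
Definition opnorm_at (R : realType) (p : \bar R) (m n : nat)
    (F : 'M[{fraction {poly R[i]}}]_(m, n)) (s : R[i]) : \bar R :=
  if pselect (exists M, mx_frac_value F s M) is left exM
  then opnorm p (projT1 (cid exM)) else +oo%E.

(* Main.v *)
Require Import Defs.
From HB Require Import structures.
From mathcomp Require Import all_boot all_order all_algebra fraction.
From mathcomp Require Import complex.
From mathcomp Require Import all_classical all_reals all_analysis.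
From mathcomp Require Import ring lra.
Set Implicit Arguments.
Unset Strict Implicit.
Unset Printing Implicit Defensive.
Import Order.TTheory GRing.Theory Num.Theory.
Import numFieldNormedType.Exports.
Local Open Scope classical_set_scope.
Local Open Scope ring_scope.

(** Let [K] be the supremum on the right, assumed finite, and [sigma = Re s > 0].
    The inequality is the estimate
    [norm (int_0^oo e^(-st) C e^(tA) B dt) <= int_0^oo e^(-sigma t) K dt = K / sigma]
    of a Laplace transform, whose value should be [C (sI - A)^-1 B].  Only
    [C e^(tA) B] is known to be bounded, not [e^(tA)] itself, so the convergence
    of the integral to that value, and the absence of poles in the right half
    plane, have to be derived.

    The integral is replaced by a geometric series.  For a step [h > 0] put
    [E = e^(hA)] and [u = 1 - s h], the Euler approximation of [e^(-sh)].  The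
    matrices [C E^k B = C e^(khA) B] have norm at most [K], so the Neumann series
    of [F = 1 - u E] gives [(1 - |u|) norm (C F^-1 B) <= K]; see
    [discrete_resolvent_bound].  The remainder [u^n C F^-1 E^n B] of that series
    tends to [0] since, by Cayley-Hamilton, [F^-1] is a polynomial in [E], hence
    [C F^-1 E^n B] is a combination of a fixed number of matrices [C E^(n+j) B]; see
    [bounded_inverse_orbit].  When [h] tends to [0], [F / h] tends to [sI - A] and
    [(1 - |u|) / h] to [sigma], which yields [resolvent_bound] for every [s] that
    is not an eigenvalue of [A].

    An eigenvalue [s] with [Re s > 0] is the limit of the points [s + 1/(k+1)],
    which finally avoid the spectrum.  The entries of the transfer matrix are
    bounded along this sequence, so [s] is not a pole ([frac_value_of_bounded]),
    and the bound passes to the limit ([frac_value_cvg]). *)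

Local Notation normc := Normc.normc.
Local Notation rc := (real_complex _).

(** * The modulus of complex numbers *)

Section Modulus.
Context {R : realType}.
Implicit Types z w : R[i].

Lemma normc_ge0 z : 0 <= normc z.
Proof. by case: z => a b; exact: sqrtr_ge0. Qed.

Lemma normcD z w : normc (z + w) <= normc z + normc w.
Proof. exact: le_normcD. Qed.

Lemma normcB z w : normc (z - w) = normc (w - z).
Proof. by rewrite -normcN opprB. Qed.

Lemma normc_normr z : `|z| = (normc z)%:C%C.
Proof. by case: z => a b; rewrite normc_def. Qed.

Lemma normc_real (a : R) : normc a%:C%C = `|a|.
Proof. by rewrite /= expr0n addr0 sqrtr_sqr. Qed.

Lemma normc_sqrE z : normc z ^+ 2 = complex.Re z ^+ 2 + complex.Im z ^+ 2.
Proof. by case: z => a b; rewrite sqr_sqrtr// addr_ge0// sqr_ge0. Qed.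

Lemma normcX z n : normc (z ^+ n) = normc z ^+ n.
Proof.
by elim: n => [|n IH]; rewrite ?expr0 ?Normc.normc1// !exprS Normc.normcM IH.
Qed.

Lemma normc_sum (I : Type) (r : seq I) (P : pred I) (F : I -> R[i]) :
  normc (\sum_(i <- r | P i) F i) <= \sum_(i <- r | P i) normc (F i).
Proof.
elim/big_rec2 : _ => [|i y1 y2 _ H]; first by rewrite Normc.normc0.
exact: le_trans (normcD _ _) (lerD _ _).
Qed.

Lemma Re_le_normc z : `|complex.Re z| <= normc z.
Proof.
by have := normc_ge_Re z; rewrite normc_normr lecR.
Qed.

Lemma Im_le_normc z : `|complex.Im z| <= normc z.
Proof.
by case: z => a b /=; rewrite -sqrtr_sqr ler_wsqrtr// lerDr sqr_ge0.
Qed.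

Lemma normc_le_ReIm z : normc z <= `|complex.Re z| + `|complex.Im z|.
Proof.
case: z => a b.
have -> : (a +i* b)%C = a%:C%C + (0 +i* b)%C by rewrite /GRing.add /= addr0 add0r.
rewrite (le_trans (normcD _ _))// normc_real /= addr0 lerD// expr0n add0r.
by rewrite sqrtr_sqr add0r.
Qed.

(** The norm of [R[i]] takes its values in [R[i]]; this reduces complex limits to
    limits of real numbers, where the order is total. *)
Lemma cvg_normcP (u : nat -> R[i]) (l : R[i]) :
  ((u k : R[i]^o) @[k --> \oo] --> (l : R[i]^o)) <->
  (normc (u k - l) @[k --> \oo] --> (0 : R)).
Proof.
split=> H.
  apply/cvgr0Pnorm_lt => e e0.
  have e0C : 0 < e%:C%C :> R[i] by rewrite ltcR.
  have /cvgrPdist_lt/(_ _ e0C) := H; apply: filterS => k /=.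
  by rewrite normc_normr ltcR normcB ger0_norm ?normc_ge0.
apply/cvgrPdist_lt => -[e f]; rewrite ltcE /= => /andP[/eqP -> e0].
have /cvgr0Pnorm_lt/(_ _ e0) := H; apply: filterS => k /=.
by rewrite normc_normr ltcR normcB ger0_norm ?normc_ge0.
Qed.

Lemma cvg_real_complex (u : nat -> R) (l : R) :
  u k @[k --> \oo] --> l -> ((u k)%:C%C : R[i]^o) @[k --> \oo] --> (l%:C%C : R[i]^o).
Proof.
move=> ul; apply/cvg_normcP.
under eq_cvg do rewrite -(rmorphB (real_complex R)) normc_real.
by apply/norm_cvg0P; rewrite -(subrr l); apply: cvgB => //; exact: cvg_cst.
Qed.

Lemma normc_le_cvg (u : nat -> R[i]) (l : R[i]) (c : R) :
  ((u k : R[i]^o) @[k --> \oo] --> (l : R[i]^o)) ->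
  (\forall k \near \oo, normc (u k) <= c) -> normc l <= c.
Proof.
move=> /cvg_normcP ul uc.
have H : (c + normc (u k - l)) @[k --> \oo] --> c + 0.
  by apply: cvgD; [exact: cvg_cst|exact: ul].
rewrite addr0 in H.
rewrite -(cvg_lim _ H)//; apply: limr_ge; first by apply/cvg_ex; exists c.
near=> k; apply: (@le_trans _ _ (normc (u k) + normc (l - u k))).
  by rewrite -[in leLHS](subrKC (u k) l) normcD.
by rewrite normcB lerD2r; near: k.
Unshelve. all: by end_near. Qed.

End Modulus.

(** * The vector p-norms *)

Section Minkowski.
Context {R : realType} {I : finType} (r : R) (r1 : 1 <= r).
Implicit Types a b : I -> R.

Let r0 : 0 < r. Proof. exact: lt_le_trans r1. Qed.
Let rn0 : r != 0. Proof. exact: lt0r_neq0. Qed.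

Let S a := (\sum_i a i `^ r) `^ r^-1.

Let sum_ge0 a : 0 <= \sum_i a i `^ r.
Proof. by apply: sumr_ge0 => i _; exact: powR_ge0. Qed.

Let SE a : S a `^ r = \sum_i a i `^ r.
Proof. by rewrite -powRrM mulVf// powRr1. Qed.

Let S_eq0 a : S a = 0 -> forall i, a i = 0.
Proof.
move=> Sa i; have /eqP := SE a.
rewrite Sa powR0// eq_sym psumr_eq0; last by move=> j _; exact: powR_ge0.
by move=> /allP/(_ i (mem_index_enum i)); rewrite powR_eq0 => /andP[/eqP].
Qed.

(** After division by their norms both families have norm [1].  The normalized sum
    is their convex combination with weights proportional to the two norms, so
    convexity of the power function bounds its norm by [1]. *)
Lemma minkowski_sum a b : (forall i, 0 <= a i) -> (forall i, 0 <= b i) ->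
  (\sum_i (a i + b i) `^ r) `^ r^-1
    <= (\sum_i a i `^ r) `^ r^-1 + (\sum_i b i `^ r) `^ r^-1.
Proof.
move=> a0 b0; rewrite -/(S a) -/(S b).
have [Sa|Sa] := eqVneq (S a) 0.
  by rewrite Sa add0r (eq_bigr (fun i => b i `^ r))// => i _; rewrite S_eq0 ?add0r.
have [Sb|Sb] := eqVneq (S b) 0.
  rewrite Sb addr0 (eq_bigr (fun i => a i `^ r))// => i _.
  by rewrite (S_eq0 Sb) addr0.
have Sa0 : 0 < S a by rewrite lt_neqAle eq_sym Sa powR_ge0.
have Sb0 : 0 < S b by rewrite lt_neqAle eq_sym Sb powR_ge0.
move: (S a) (S b) Sa0 Sb0 (SE a) (SE b) => u v u0 v0 au bv {Sa Sb}.
have uv0 : 0 < u + v by exact: addr_gt0.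
set t := u / (u + v).
have t0 : 0 <= t by rewrite divr_ge0// ltW.
have t1 : t <= 1 by rewrite ler_pdivrMr// mul1r lerDl ltW.
have onemt : 1 - t = v / (u + v).
  by rewrite -[1](divff (lt0r_neq0 uv0)) -mulrBl addrAC subrr add0r.
have cvx i : (a i + b i) `^ r <=
    (u + v) `^ r * (t * (a i `^ r / u `^ r) + (1 - t) * (b i `^ r / v `^ r)).
  have -> : a i + b i = (u + v) * (t * (a i / u) + (1 - t) * (b i / v)).
    by rewrite onemt /t; field; rewrite !lt0r_neq0.
  have ai : 0 <= a i / u by rewrite divr_ge0// ltW.
  have bi : 0 <= b i / v by rewrite divr_ge0// ltW.
  rewrite powRM ?(ltW uv0)//; last first.
    by rewrite addr_ge0// mulr_ge0// subr_ge0.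
  rewrite ler_wpM2l ?powR_ge0//.
  have inv c d : 0 <= c -> 0 < d -> c `^ r / d `^ r = (c / d) `^ r.
    move=> c0 d0; rewrite powRM// ?invr_ge0 ?(ltW d0)//; congr (_ * _).
    apply: (mulIf (lt0r_neq0 (powR_gt0 r d0))).
    by rewrite -powRM ?invr_ge0 ?(ltW d0)// !mulVf ?powR1// lt0r_neq0 ?powR_gt0.
  rewrite !inv//.
  by apply: (convex_powR r1 (Itv01 t0 t1)) => //=; rewrite inE/= in_itv/= andbT.
rewrite -[leRHS](@powRr1 _ (u + v)) ?(ltW uv0)// -(mulfV rn0) powRrM.
rewrite ge0_ler_powR ?invr_ge0 ?(ltW r0) ?nnegrE ?powR_ge0//.
rewrite (le_trans (ler_sum _ (fun i _ => cvx i)))// -mulr_sumr big_split/=.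
rewrite -!mulr_sumr -!mulr_suml -au -bv !divff ?lt0r_neq0 ?powR_gt0//.
by rewrite !mulr1 subrKC mulr1.
Qed.

End Minkowski.

Section PNorm.
Context {R : realType} (p : \bar R) (hp : (1 <= p)%E).
Implicit Types (a : R[i]).

Lemma pnorm_ge0 n (x : 'cV[R[i]]_n) : 0 <= pnorm p x.
Proof.
by case: p => [r||]//=; [exact: powR_ge0|exact: bigmax_ge_id].
Qed.

Lemma pnormZ n a (x : 'cV[R[i]]_n) : pnorm p (a *: x) = normc a * pnorm p x.
Proof.
case: p hp => [r||]//= r1; last first.
  have [a0|an0] := eqVneq (normc a) 0.
    rewrite a0 mul0r big1_idem ?maxxx//= ?maxxx// => i _.
    by rewrite mxE Normc.normcM a0 mul0r.
  under eq_bigr do rewrite mxE Normc.normcM.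
  rewrite (big_morph (fun y => normc a * y) (id1 := 0) (op1 := Num.max)) ?mulr0//.
  by move=> u v; rewrite maxr_pMr ?normc_ge0.
rewrite lee_fin in r1; have r0 : r != 0 by rewrite lt0r_neq0// (lt_le_trans _ r1).
under eq_bigr do rewrite mxE Normc.normcM powRM ?normc_ge0//.
rewrite -mulr_sumr powRM ?powR_ge0 ?sumr_ge0//; last first.
  by move=> i _; exact: powR_ge0.
by rewrite -powRrM mulfV// powRr1 ?normc_ge0.
Qed.

Lemma pnorm0 n : pnorm p (0 : 'cV[R[i]]_n) = 0.
Proof. by rewrite -(scale0r 0) pnormZ Normc.normc0 mul0r. Qed.

Lemma pnormD n (x y : 'cV[R[i]]_n) : pnorm p (x + y) <= pnorm p x + pnorm p y.
Proof.
case: p hp => [r||]//= r1; last first.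
  apply: bigmax_le => [|i _]; first by rewrite addr_ge0// bigmax_ge_id.
  rewrite mxE (le_trans (normcD _ _))// lerD//;
    exact: (le_bigmax _ (fun k => normc (_ k 0))).
rewrite lee_fin in r1; have r0 : 0 < r by rewrite (lt_le_trans _ r1).
apply: le_trans (minkowski_sum r1 _ _); [|by move=> i; exact: normc_ge0..].
rewrite ge0_ler_powR ?invr_ge0 ?(ltW r0) ?nnegrE//.
- by apply: sumr_ge0 => i _; exact: powR_ge0.
- by apply: sumr_ge0 => i _; exact: powR_ge0.
apply: ler_sum => i _; rewrite mxE ge0_ler_powR ?(ltW r0) ?nnegrE ?normc_ge0//.
- by rewrite addr_ge0 ?normc_ge0.
- exact: normcD.
Qed.

Lemma pnorm_sum n (I : Type) (s : seq I) (F : I -> 'cV[R[i]]_n) :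
  pnorm p (\sum_(k <- s) F k) <= \sum_(k <- s) pnorm p (F k).
Proof.
elim/big_rec2 : _ => [|i y1 y2 _ H]; first by rewrite pnorm0.
exact: le_trans (pnormD _ _) (lerD _ _).
Qed.

Lemma pnorm_delta n (k : 'I_n) : pnorm p (delta_mx k 0 : 'cV[R[i]]_n) = 1.
Proof.
case: p hp => [r||]//= r1; last first.
  apply/eqP; rewrite eq_le; apply/andP; split.
    apply: bigmax_le => // i _; rewrite mxE.
    by case: (_ && _); rewrite ?Normc.normc1 ?Normc.normc0.
  rewrite -[leLHS](@Normc.normc1 R).
  have -> : (1%C : R[i]) = (delta_mx k 0 : 'cV[R[i]]_n) k 0 by rewrite mxE !eqxx.
  exact: (le_bigmax _ (fun i => normc (_ i 0))).
rewrite lee_fin in r1; have r0 : r != 0 by rewrite lt0r_neq0// (lt_le_trans _ r1).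
rewrite (bigD1 k)//= mxE !eqxx Normc.normc1 powR1 big1 ?addr0 ?powR1// => i ik.
by rewrite mxE (negPf ik) Normc.normc0 powR0.
Qed.

Lemma pnorm_le_l1 n (x : 'cV[R[i]]_n) : pnorm p x <= \sum_k normc (x k 0).
Proof.
have -> : x = \sum_k x k 0 *: delta_mx k 0.
  rewrite [LHS]matrix_sum_delta; apply: eq_bigr => k _.
  by rewrite big_ord_recl big_ord0 addr0.
rewrite (le_trans (pnorm_sum _ _))//; apply: ler_sum => k _.
rewrite pnormZ pnorm_delta mulr1 summxE (bigD1 k)//= big1 ?addr0; last first.
  by move=> j jk; rewrite !mxE eq_sym (negPf jk) mulr0.
by rewrite !mxE !eqxx mulr1.
Qed.

Lemma normc_le_pnorm n (x : 'cV[R[i]]_n) k : normc (x k 0) <= pnorm p x.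
Proof.
case: p hp => [r||]//= r1; last exact: (le_bigmax _ (fun i => normc (x i 0))).
rewrite lee_fin in r1; have r0 : 0 < r by rewrite (lt_le_trans _ r1).
rewrite -[leLHS]powRr1 ?normc_ge0// -[X in _ `^ X](mulfV (lt0r_neq0 r0)) powRrM.
rewrite ge0_ler_powR ?invr_ge0 ?(ltW r0) ?nnegrE ?powR_ge0 ?sumr_ge0//.
  by move=> i _; exact: powR_ge0.
by rewrite (bigD1 k)//= lerDl sumr_ge0// => i _; exact: powR_ge0.
Qed.

(** The difference from the limit is controlled by the 1-norm, which dominates the
    p-norm and is continuous in the entries. *)
Lemma pnorm_le_cvg n (x : nat -> 'cV[R[i]]_n) (y : 'cV[R[i]]_n) (c : R) :
  (forall k, (x m k 0 : R[i]^o) @[m --> \oo] --> (y k 0 : R[i]^o)) ->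
  (\forall m \near \oo, pnorm p (x m) <= c) -> pnorm p y <= c.
Proof.
move=> xy xc.
have H : (c + \sum_k normc (x m k 0 - y k 0)) @[m --> \oo] --> c + \sum_(k < n) (0 : R).
  apply: cvgD; first exact: cvg_cst.
  by apply: (cvg_big add_continuous) => k _; exact/cvg_normcP.
rewrite sumr_const mul0rn addr0 in H.
rewrite -(cvg_lim _ H)//; apply: limr_ge; first by apply/cvg_ex; exists c.
near=> m.
rewrite -[in leLHS](subrKC (x m) y) (le_trans (pnormD _ _))// lerD//.
  by near: m.
rewrite (le_trans (pnorm_le_l1 _))//; apply: ler_sum => k _.
by rewrite !mxE normcB.
Unshelve. all: by end_near. Qed.

End PNorm.

(** * Entrywise norm of matrices and the exponential series *)

Section L1Norm.
Context {R : realType}.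

(** This matrix norm is submultiplicative, so that it dominates powers of a matrix by
    powers of a number, and it bounds each entry. *)
Definition l1norm m n (M : 'M[R[i]]_(m, n)) : R := \sum_i \sum_j normc (M i j).

Lemma l1norm_ge0 m n (M : 'M[R[i]]_(m, n)) : 0 <= l1norm M.
Proof. by do 2!apply: sumr_ge0 => ? _; exact: normc_ge0. Qed.

Lemma normc_le_l1norm m n (M : 'M[R[i]]_(m, n)) i j : normc (M i j) <= l1norm M.
Proof.
rewrite /l1norm (bigD1 i)//= (bigD1 j)//= -addrA lerDl addr_ge0//.
  by apply: sumr_ge0 => ? _; exact: normc_ge0.
by do 2!apply: sumr_ge0 => ? _; exact: normc_ge0.
Qed.

Lemma l1normM m n q (M : 'M[R[i]]_(m, n)) (M' : 'M[R[i]]_(n, q)) :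
  l1norm (M *m M') <= l1norm M * l1norm M'.
Proof.
have rowM' k : \sum_j normc (M' k j) <= l1norm M'.
  rewrite /l1norm (bigD1 k)//= lerDl.
  by do 2!apply: sumr_ge0 => ? _; exact: normc_ge0.
rewrite {1}/l1norm {1}/l1norm mulr_suml; apply: ler_sum => i _.
apply: (@le_trans _ _ (\sum_k normc (M i k) * \sum_j normc (M' k j))).
  under [leRHS]eq_bigr do rewrite mulr_sumr.
  rewrite exchange_big/=; apply: ler_sum => j _; rewrite mxE.
  apply: le_trans (normc_sum _ _ _) _.
  by apply: ler_sum => k _; rewrite Normc.normcM.
by rewrite mulr_suml; apply: ler_sum => k _; rewrite ler_wpM2l ?normc_ge0.
Qed.

Lemma l1normX n (M : 'M[R[i]]_n.+1) k :
  l1norm (M ^+ k) <= l1norm (1%:M : 'M[R[i]]_n.+1) * l1norm M ^+ k.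
Proof.
elim: k => [|k IH]; first by rewrite !expr0 mulr1.
rewrite !exprSr mulrA (le_trans (l1normM _ _))//.
by rewrite ler_wpM2r ?l1norm_ge0.
Qed.

Lemma horner_mxE (K : comNzRingType) n (M : 'M[K]_n.+1) (q : {poly K}) :
  horner_mx M q = \sum_(k < size q) q`_k *: M ^+ k.
Proof.
rewrite -{1}[q]coefK poly_def rmorph_sum; apply: eq_bigr => k _.
by rewrite /= horner_mxZ rmorphXn/= horner_mx_X.
Qed.

(** Reduces estimates on power series in a matrix to the scalar series. *)
Lemma normc_horner_mx n (M : 'M[R[i]]_n.+1) (q : {poly R}) i j :
  (forall k, 0 <= q`_k) ->
  normc (horner_mx M (map_poly rc q) i j)
    <= l1norm (1%:M : 'M[R[i]]_n.+1) * q.[l1norm M].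
Proof.
move=> q0; rewrite horner_mxE size_map_poly summxE (le_trans (normc_sum _ _ _))//.
rewrite horner_coef mulr_sumr; apply: ler_sum => k _.
rewrite coef_map mxE Normc.normcM normc_real ger0_norm// mulrCA ler_wpM2l//.
exact: le_trans (normc_le_l1norm _ _ _) (l1normX _ _).
Qed.

End L1Norm.

Section Exponential.
Context {R : realType}.

(** The truncated exponential series of [a 'X]: having ['X] as a formal variable, one
    polynomial identity serves both the matrix and the norm of the matrix. *)
Definition exp_poly (n : nat) (a : R) : {poly R} := \poly_(k < n) (a ^+ k / k`!%:R).

Lemma horner_exp_poly n a x : (exp_poly n a).[x] = series (exp_coeff (a * x)) n.
Proof.
rewrite horner_poly /series/= big_mkord; apply: eq_bigr => k _.
by rewrite /exp_coeff/= exprMn mulrAC.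
Qed.

Lemma coef_exp_poly_ge0 n a k : 0 <= a -> 0 <= (exp_poly n a)`_k.
Proof.
by move=> a0; rewrite coef_poly; case: ifP => // _; rewrite divr_ge0// exprn_ge0.
Qed.

(** Up to degree [n - 1] the product agrees with the exponential series of
    [a + b], by the binomial formula; the terms above are non-negative. *)
Lemma coef_exp_polyM_ge0 n a b k : 0 <= a -> 0 <= b ->
  0 <= (exp_poly n a * exp_poly n b - exp_poly n (a + b))`_k.
Proof.
move=> a0 b0; rewrite coefB coefM [(exp_poly n (a + b))`_k]coef_poly.
case: ltnP => kn; last first.
  rewrite subr0; apply: sumr_ge0 => i _.
  by rewrite mulr_ge0 ?coef_exp_poly_ge0.
rewrite (_ : \sum_(_ < _) _ = (a + b) ^+ k / k`!%:R) ?subrr//.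
rewrite addrC exprDn mulr_suml; apply: eq_bigr => i _.
have ik : (i <= k)%N by rewrite -ltnS.
rewrite !coef_poly (leq_ltn_trans ik kn) (leq_ltn_trans (leq_subr _ _) kn).
rewrite -(bin_fact ik) !natrM -mulr_natr.
have C0 : ('C(k, i)%:R : R) != 0 by rewrite pnatr_eq0 -lt0n bin_gt0.
have f0 m : (m`!%:R : R) != 0 by rewrite pnatr_eq0 -lt0n fact_gt0.
by field; rewrite C0 !f0.
Qed.

Context {n : nat}.
Implicit Types (a b : R) (A M : 'M[R[i]]_n.+1).

Definition exp_sum M m := series (fun k => k`!%:R^-1 *: M ^+ k) m.

Lemma exp_sum_horner a A m :
  exp_sum (rc a *: A) m = horner_mx A (map_poly rc (exp_poly m a)).
Proof.
rewrite /exp_sum /series/= big_mkord /exp_poly poly_def !rmorph_sum/=.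
apply: eq_bigr => k _.
rewrite map_polyZ/= map_polyXn horner_mxZ rmorphXn/= horner_mx_X.
by rewrite exprZn scalerA rmorphM/= fmorphV/= rmorphXn/= rmorph_nat mulrC.
Qed.

(** The real and the imaginary part of each entry are dominated by a real exponential
    series. *)
Lemma cvg_expmx M i j :
  (exp_sum M m i j : R[i]^o) @[m --> \oo] --> (expmx M i j : R[i]^o).
Proof.
pose u i j k : R[i] := (k`!%:R^-1 *: M ^+ k) i j.
have ub i' j' k : normc (u i' j' k)
    <= l1norm (1%:M : 'M[R[i]]_n.+1) * exp_coeff (l1norm M) k.
  rewrite /u mxE Normc.normcM -(rmorph_nat rc) -fmorphV normc_real.
  rewrite ger0_norm ?invr_ge0// /exp_coeff/= mulrA mulrC.
  rewrite ler_wpM2r ?invr_ge0//.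
  exact: le_trans (normc_le_l1norm _ _ _) (l1normX _ _).
have part i' j' (f : {additive R[i] -> R}) :
    (forall z, `|f z| <= normc z) -> cvgn (series (fun k => f (u i' j' k))).
  move=> fle; apply: normed_cvg; apply: (@series_le_cvg _ _
    (fun k => l1norm (1%:M : 'M[R[i]]_n.+1) * exp_coeff (l1norm M) k)).
  - by move=> k /=; exact: normr_ge0.
  - move=> k; rewrite mulr_ge0 ?l1norm_ge0 ?exp_coeff_ge0 ?l1norm_ge0//.
  - by move=> k; apply: le_trans (fle _) (ub i' j' k).
  apply: is_cvg_seriesZ; exact: is_cvg_series_exp_coeff.
have ent i' j' : exists l : R[i], (exp_sum M m i' j' : R[i]^o) @[m --> \oo] --> (l : R[i]^o).
  have /cvg_ex[x xl] := part i' j' (@complex.Re R) Re_le_normc.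
  have /cvg_ex[y yl] := part i' j' (@complex.Im R) Im_le_normc.
  exists (x +i* y)%C; apply/cvg_normcP.
  have fE (f : {additive R[i] -> R}) m :
      f (exp_sum M m i' j') = series (fun k => f (u i' j' k)) m.
    by rewrite /exp_sum /series/= summxE raddf_sum.
  have lim0 (v : nat -> R) l : v m @[m --> \oo] --> l -> `|v m - l| @[m --> \oo] --> (0 : R).
    by move=> vl; apply/norm_cvg0P; rewrite -(subrr l); apply: cvgB => //; exact: cvg_cst.
  apply: (@squeeze_cvgr _ _ _ _ (fun=> 0) (fun m =>
    `|series (fun k => complex.Re (u i' j' k)) m - x|
    + `|series (fun k => complex.Im (u i' j' k)) m - y|)).
  - near=> m; rewrite normc_ge0/= (le_trans (normc_le_ReIm _))//.
    by rewrite !raddfB/= !fE.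
  - exact: cvg_cst.
  - by rewrite -[0]addr0; apply: cvgD; apply: lim0.
have cvgS : cvgn (exp_sum M : nat -> 'M[R[i]^o]_n.+1).
  pose l i' j' := projT1 (cid (ent i' j')).
  (* Convergence of matrices follows from that of the entries by expanding on
     the canonical basis. *)
  apply/cvg_ex; exists (\sum_i' \sum_j' l i' j' *: delta_mx i' j' : 'M[R[i]^o]_n.+1).
  rewrite (_ : exp_sum M =
      fun m => \sum_i' \sum_j' exp_sum M m i' j' *: delta_mx i' j'); last first.
    by apply/funext => m; exact: matrix_sum_delta.
  apply: (cvg_big add_continuous) => i' _; apply: (cvg_big add_continuous) => j' _.
  by apply: cvgZr_tmp; exact: projT2 (cid (ent i' j')).
exact: (cvg_comp _ _ cvgS (@coord_continuous R[i] _ _ i j _)).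
Unshelve. all: by end_near. Qed.

End Exponential.

(** * Functional equation and first-order expansion of the exponential *)

Section ExponentialLaw.
Context {R : realType} {n : nat}.
Implicit Types (a b : R) (A : 'M[R[i]]_n.+1).

(** Truncations of both sides differ by a polynomial in [A] with non-negative
    coefficients; its value at the norm of [A] is the same difference for the
    real exponential, which tends to [0]. *)
Lemma expmxD A a b : 0 <= a -> 0 <= b ->
  expmx (rc (a + b) *: A) = expmx (rc a *: A) *m expmx (rc b *: A).
Proof.
move=> a0 b0; apply/matrixP => i j; rewrite mxE; apply/eqP; rewrite eq_sym -subr_eq0.
pose d m := \sum_k exp_sum (rc a *: A) m i k * exp_sum (rc b *: A) m k j
  - exp_sum (rc (a + b) *: A) m i j.
set l := (X in X == 0).
have dl : (d m : R[i]^o) @[m --> \oo] --> (l : R[i]^o).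
  apply: cvgB; last exact: cvg_expmx.
  by apply: (cvg_big add_continuous) => k _; apply: cvgM; exact: cvg_expmx.
suff d0 : (d m : R[i]^o) @[m --> \oo] --> (0 : R[i]^o).
  by apply/eqP; apply: (cvg_unique _ dl d0); exact: norm_hausdorff.
apply/cvg_normcP; set x := l1norm A.
pose e c m := series (exp_coeff (c * x)) m.
apply: (@squeeze_cvgr _ _ _ _ (fun=> 0) (fun m =>
  l1norm (1%:M : 'M[R[i]]_n.+1) * (e a m * e b m - e (a + b) m))).
- near=> m; rewrite normc_ge0/= subr0.
  have -> : d m = horner_mx A
      (map_poly rc (exp_poly m a * exp_poly m b - exp_poly m (a + b))) i j.
    by rewrite !rmorphB/= !rmorphM/= /d !exp_sum_horner !mxE.
  apply: le_trans (normc_horner_mx _ _ _ _) _.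
    by move=> k; exact: coef_exp_polyM_ge0.
  by rewrite hornerD hornerN hornerM !horner_exp_poly.
- exact: cvg_cst.
- have ce c : e c m @[m --> \oo] --> expR (c * x) by exact: is_cvg_series_exp_coeff.
  rewrite -(mulr0 (l1norm (1%:M : 'M[R[i]]_n.+1))).
  apply: cvgM; first exact: cvg_cst.
  rewrite -(subrr (expR (a * x) * expR (b * x))).
  apply: cvgB; first by apply: cvgM; exact: ce.
  by rewrite -expRD -mulrDl; exact: ce.
Unshelve. all: by end_near. Qed.

(** All terms of degree at least [2] carry a factor [h ^+ k <= h ^+ 2], which leaves a
    convergent series independent of [h]. *)
Lemma expmx_taylor1 A : exists c : R, forall h : R, 0 <= h <= 1 ->
  forall i j, normc ((expmx (rc h *: A) - 1 - rc h *: A) i j) <= c * h ^+ 2.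
Proof.
set x := l1norm A; set y := l1norm (1%:M : 'M[R[i]]_n.+1).
exists (y * expR x) => h /andP[h0 h1] i j.
apply: (@normc_le_cvg _ (fun m => (exp_sum (rc h *: A) m - 1 - rc h *: A) i j)).
  have mxB (M M' : 'M[R[i]]_n.+1) : (M - M') i j = M i j - M' i j by rewrite !mxE.
  rewrite !mxB; under eq_cvg do rewrite !mxB.
  by apply: cvgB; [apply: cvgB|]; [exact: cvg_expmx|exact: cvg_cst|exact: cvg_cst].
near=> m; have m2 : (2 <= m)%N by near: m; exact: nbhs_infty_ge.
pose q := exp_poly m h - 1 - h *: 'X.
have -> : exp_sum (rc h *: A) m - 1 - rc h *: A = horner_mx A (map_poly rc q).
  by rewrite !rmorphB/= !rmorph1 map_polyZ map_polyX/= horner_mxZ horner_mx_X exp_sum_horner.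
have qE k : q`_k = if (2 <= k < m)%N then h ^+ k / k`!%:R else 0.
  rewrite !coefB coef1 coefZ coefX coef_poly.
  case: k => [|[|k]]; rewrite /= ?mulr0 ?mulr1 ?subr0//.
    by rewrite (ltn_trans _ m2)// expr0 divr1 subrr.
  by rewrite m2 expr1 divr1 subrr.
apply: le_trans (normc_horner_mx _ _ _ _) _.
  by move=> k; rewrite qE; case: ifP => // _; rewrite divr_ge0// exprn_ge0.
rewrite -mulrA ler_wpM2l ?l1norm_ge0// -/x.
have x0 : 0 <= x := l1norm_ge0 A.
have sz : (size q <= m)%N.
  by apply/leq_sizeP => k mk; rewrite qE [(k < m)%N]ltnNge mk andbF.
rewrite (horner_coef_wide _ sz).
apply: (@le_trans _ _ (h ^+ 2 * \sum_(k < m) exp_coeff x k)); last first.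
  rewrite mulrC ler_wpM2r ?sqr_ge0//.
  have := @nondecreasing_cvgn_le _ _ _ (is_cvg_series_exp_coeff x) m.
  rewrite /series/= big_mkord; apply; apply/nondecreasing_seqP => k.
  by rewrite !big_mkord big_ord_recr/= lerDl exp_coeff_ge0.
rewrite mulr_sumr; apply: ler_sum => k _; rewrite qE.
case: ifP => [/andP[k2 km]|_]; last by rewrite mul0r mulr_ge0 ?sqr_ge0 ?exp_coeff_ge0.
rewrite /exp_coeff/= mulrAC -mulrA ler_wpM2r ?ler_wiXn2l//.
by rewrite divr_ge0// exprn_ge0.
Unshelve. all: by end_near. Qed.

Lemma expmx0 A : expmx (rc 0 *: A) = 1.
Proof.
have [c cA] := expmx_taylor1 A.
apply/matrixP => i j; apply/eqP; rewrite -subr_eq0.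
have := cA 0; rewrite lexx ler01 => /(_ isT i j).
rewrite expr0n mulr0 !mxE rmorph0 mul0r subr0 => H.
by apply/eqP/Normc.eq0_normc/eqP; rewrite eq_le normc_ge0 andbT.
Qed.

Lemma expmx_natmul A h k : 0 <= h ->
  expmx (rc (k%:R * h) *: A) = expmx (rc h *: A) ^+ k.
Proof.
move=> h0; elim: k => [|k IH]; first by rewrite mul0r expmx0 expr0.
by rewrite -natr1 mulrDl mul1r expmxD ?mulr_ge0// IH exprSr.
Qed.

End ExponentialLaw.

(** * Neumann series of a matrix seen through bounded moments *)

Section Discrete.
Context {R : realType} (p : \bar R) (hp : (1 <= p)%E).
Context {n Q : nat} (C : 'M[R[i]]_(Q, n.+1)) (E : 'M[R[i]]_n.+1) (b : 'cV[R[i]]_n.+1).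
Context (u : R[i]) (K : R).
Let F := 1 - u *: E.
Hypothesis CEb : forall k, pnorm p (C *m E ^+ k *m b) <= K.
Hypothesis unitF : F \in unitmx.

(** [tame] is stable under linear combinations and right multiplication by [E], hence
    by [F], so it contains all polynomials in [F]. *)
Let tame Y := exists c, forall k, pnorm p (C *m Y *m E ^+ k *m b) <= c.

(** By Cayley-Hamilton and invertibility, [invmx F] is a polynomial in [F]. *)
Lemma bounded_inverse_orbit :
  exists c, forall k, pnorm p (C *m invmx F *m E ^+ k *m b) <= c.
Proof.
have tame1 : tame 1 by exists K => k; rewrite mulmx1.
have tameD Y Z : tame Y -> tame Z -> tame (Y + Z).
  move=> [c Yc] [d Zd]; exists (c + d) => k.
  by rewrite mulmxDr !mulmxDl (le_trans (pnormD hp _ _))// lerD.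
have tameZ a Y : tame Y -> tame (a *: Y).
  move=> [c Yc]; exists (normc a * c) => k.
  by rewrite -scalemxAr -!scalemxAl pnormZ// ler_wpM2l ?normc_ge0.
have tameE Y : tame Y -> tame (Y *m E).
  move=> [c Yc]; exists c => k.
  by rewrite mulmxA -[_ *m E *m _]mulmxA -[E *m _]exprS.
have tameF Y : tame Y -> tame (Y *m F).
  move=> tY; rewrite /F mulmxBr mulmx1 -scaleN1r -scalemxAr.
  by apply: (tameD _ _ tY); apply: (tameZ _ _ (tameZ _ _ (tameE _ tY))).
have tameX k : tame (F ^+ k) by elim: k => [//|k IH]; rewrite exprSr; exact: tameF.
suff -> : invmx F = - ((char_poly F)`_0)^-1 *: horner_mx F (drop_poly 1 (char_poly F)).
  apply: (tameZ).
  rewrite horner_mxE.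
  apply: (big_ind tame).
  - by rewrite -(scale0r (1 : 'M[R[i]]_n.+1)); exact: (tameZ).
  - exact: (tameD).
  - by move=> k _; exact: (tameZ).
have c0 : (char_poly F)`_0 != 0.
  by rewrite char_poly_det mulf_neq0 ?signr_eq0// -unitfE -unitmxE.
(* The constant coefficient is the determinant up to sign; the other terms of the
   characteristic polynomial contain a factor [F]. *)
have := Cayley_Hamilton F; rewrite -{1}(poly_take_drop 1 (char_poly F)).
have -> : take_poly 1 (char_poly F) = ((char_poly F)`_0)%:P.
  by apply/polyP => -[|k]; rewrite coef_take_poly coefC.
rewrite rmorphD rmorphM/= horner_mx_C horner_mx_X => /eqP.
rewrite addrC addr_eq0 => /eqP qF.
apply: (can_inj (mulmxK unitF)); rewrite mulVmx// -scalemxAl [_ *m F]qF.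
by rewrite scalerN scaleNr opprK -mul_scalar_mx -scalar_mxM mulVf.
Qed.

(** The Neumann series of [F = 1 - u E] converges when applied to [b] and seen through
    [C], although [E] itself need not be power bounded: its remainder is [u ^+ m]
    times a bounded vector. *)
Lemma discrete_resolvent_bound : normc u < 1 ->
  (1 - normc u) * pnorm p (C *m invmx F *m b) <= K.
Proof.
move=> u1; have [c0 cE] := bounded_inverse_orbit.
have c_ge0 : 0 <= c0 := le_trans (pnorm_ge0 _ _) (cE 0).
have K_ge0 : 0 <= K := le_trans (pnorm_ge0 _ _) (CEb 0).
have sumE m : C *m invmx F *m b =
    \sum_(k < m) u ^+ k *: (C *m E ^+ k *m b)
    + u ^+ m *: (C *m invmx F *m E ^+ m *m b).
  elim: m => [|m IH]; first by rewrite big_ord0 add0r scale1r mulmx1.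
  rewrite {1}IH big_ord_recr/= -addrA; congr (_ + _).
  rewrite exprSr -scalerA -scalerDr; congr (_ *: _).
  have {1}-> : invmx F = 1 + u *: (invmx F *m E).
    by rewrite -[X in X + _](mulVmx unitF) {2}/F mulmxBr mulmx1 -scalemxAr subrK.
  rewrite mulmxDr mulmx1 !mulmxDl -scalemxAr -!scalemxAl.
  by rewrite exprS !mulmxA.
have bound m : (1 - normc u) * pnorm p (C *m invmx F *m b)
    <= K + c0 * normc u ^+ m.
  rewrite {1}(sumE m); set v := normc u.
  have v0 : 0 <= v := normc_ge0 _.
  apply: (@le_trans _ _ ((1 - v) * (\sum_(k < m) v ^+ k * K + v ^+ m * c0))).
    rewrite ler_wpM2l ?subr_ge0 ?(ltW u1)// (le_trans (pnormD hp _ _))// lerD//.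
      rewrite (le_trans (pnorm_sum hp _ _))//; apply: ler_sum => k _.
      by rewrite pnormZ// normcX ler_wpM2l ?exprn_ge0.
    by rewrite pnormZ// normcX ler_wpM2l ?exprn_ge0.
  have -> : (1 - v) * (\sum_(k < m) v ^+ k * K + v ^+ m * c0)
      = (1 - v ^+ m) * K + (1 - v) * (c0 * v ^+ m).
    have geo : (1 - v) * (\sum_(k < m) v ^+ k) = 1 - v ^+ m.
      by rewrite -opprB mulNr -subrX1 opprB.
    by rewrite -mulr_suml mulrDr mulrA geo [v ^+ m * c0]mulrC.
  rewrite lerD//.
    by rewrite ler_piMl// gerBl exprn_ge0.
  by rewrite ler_piMl ?mulr_ge0 ?exprn_ge0// gerBl.
have H : (K + c0 * normc u ^+ m) @[m --> \oo] --> K + c0 * 0.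
  apply: cvgD; first exact: cvg_cst.
  apply: cvgM; first exact: cvg_cst.
  by apply: cvg_expr; rewrite ger0_norm ?normc_ge0.
rewrite mulr0 addr0 in H; rewrite -(cvg_lim _ H)//.
by apply: limr_ge; [apply/cvg_ex; exists K|exact: nearW].
Qed.

End Discrete.

(** * Resolvent bound away from the spectrum *)

Section MatrixLimits.
Context {K : numFieldType} {T : Type} {F : set_system T} {FF : Filter F}.

Lemma cvg_mulmx m n q (u : T -> 'M[K]_(m, n)) (v : T -> 'M[K]_(n, q))
    (a : 'M[K]_(m, n)) (b : 'M[K]_(n, q)) :
  (forall i j, u t i j @[t --> F] --> a i j) ->
  (forall i j, v t i j @[t --> F] --> b i j) ->
  forall i j, (u t *m v t) i j @[t --> F] --> (a *m b) i j.
Proof.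
move=> ua vb i j; rewrite mxE; under eq_cvg do rewrite mxE.
by apply: (cvg_big add_continuous) => k _; exact: cvgM.
Qed.

Lemma cvg_det n (u : T -> 'M[K]_n) (a : 'M[K]_n) :
  (forall i j, u t i j @[t --> F] --> a i j) ->
  \det (u t) @[t --> F] --> \det a.
Proof.
move=> ua; apply: (cvg_big add_continuous) => s _.
apply: cvgM; first exact: cvg_cst.
by apply: (cvg_big mul_continuous) => i _; exact: ua.
Qed.

Lemma near_unitmx n (u : T -> 'M[K]_n) (a : 'M[K]_n) : a \in unitmx ->
  (forall i j, u t i j @[t --> F] --> a i j) -> \forall t \near F, u t \in unitmx.
Proof.
rewrite unitmxE unitfE => a0 ua.
by apply: filterS (cvgr_neq0 _ (cvg_det ua) a0) => t; rewrite unitmxE unitfE.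
Qed.

Lemma cvg_invmx n (u : T -> 'M[K]_n) (a : 'M[K]_n) : a \in unitmx ->
  (forall i j, u t i j @[t --> F] --> a i j) ->
  forall i j, invmx (u t) i j @[t --> F] --> invmx a i j.
Proof.
move=> ua_unit ua i j.
have det0 : \det a != 0 by rewrite -unitfE -unitmxE.
have adj : ((\det (u t))^-1 * \adj (u t) i j) @[t --> F] --> invmx a i j.
  rewrite /invmx ua_unit !mxE; apply: cvgM; first by apply: cvgV => //; exact: cvg_det.
  under eq_cvg do rewrite mxE.
  apply: cvgM; first exact: cvg_cst.
  apply: cvg_det => k l; rewrite !mxE; under eq_cvg do rewrite !mxE.
  exact: ua.
apply: cvg_trans adj; apply: near_eq_cvg.
apply: filterS (near_unitmx ua_unit ua) => t ut; rewrite /invmx ut.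
by rewrite [RHS]mxE.
Qed.

End MatrixLimits.

Section Resolvent.
Context {R : realType} (p : \bar R) (hp : (1 <= p)%E).

Let h m : R := m.+1%:R^-1.

Let h01 m : 0 < h m <= 1.
Proof. by rewrite invr_gt0 ltr0n invf_le1 ?ltr0n// ler1n. Qed.

Let h_cvg0 : h m @[m --> \oo] --> (0 : R).
Proof. exact: cvg_harmonic. Qed.

(** The factor [1 - s h] agrees with [e^(-sh)] to first order in [h], which is all
    that the limit sees. *)
Lemma cvg_euler_quotient n (A : 'M[R[i]]_n.+1) (s : R[i]) i j :
  (((rc (h m))^-1 *: (1 - (1 - s * rc (h m)) *: expmx (rc (h m) *: A))) i j
     : R[i]^o) @[m --> \oo] --> ((s%:M - A) i j : R[i]^o).
Proof.
have [c Ac] := expmx_taylor1 A.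
apply/cvg_normcP.
have H : (h m * (c + normc s * (normc (A i j) + c))) @[m --> \oo] --> (0 : R).
  rewrite -(mul0r (c + normc s * (normc (A i j) + c))).
  by apply: cvgM; [exact: h_cvg0|exact: cvg_cst].
apply: (squeeze_cvgr _ (cvg_cst 0) H).
apply: nearW => m; rewrite normc_ge0/=.
have /andP[h0 h1] := h01 m; set z := h m in h0 h1 *.
set E := expmx _; have z0 : rc z != 0 by rewrite fmorph_eq0 lt0r_neq0.
have := Ac z; rewrite (ltW h0) h1 => /(_ isT i j); rewrite -/E.
set r := E - 1 - rc z *: A => rc2.
(* The first-order terms cancel; the remainder [r] is quadratic in [z]. *)
have -> : ((rc z)^-1 *: (1 - (1 - s * rc z) *: E)) i j - (s%:M - A) i j
    = - (rc z)^-1 * r i j + s * (rc z * A i j + r i j).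
  by rewrite /r -scalemx1 !mxE; field; rewrite z0.
rewrite (le_trans (normcD _ _))// !Normc.normcM normcN Normc.normcV normc_real.
rewrite gtr0_norm// mulrDr lerD//.
  by rewrite mulrC ler_pdivrMr// mulrAC mulrC -expr2.
rewrite mulrCA ler_wpM2l ?normc_ge0// (le_trans (normcD _ _))//.
rewrite Normc.normcM normc_real gtr0_norm// mulrDr lerD//.
rewrite (le_trans rc2)// expr2 mulrA mulrC ler_wpM2l ?(ltW h0)// ler_piMr//.
have := Ac 1; rewrite ler01 lexx expr1n mulr1 => /(_ isT i j).
by apply: le_trans; exact: normc_ge0.
Qed.

(** The discrete bound for the step [h m], divided by [h m], in the limit. *)
Lemma resolvent_bound n Q (A : 'M[R[i]]_n) (C : 'M[R[i]]_(Q, n))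
    (b : 'cV[R[i]]_n) (s : R[i]) (K : R) :
  (forall t, 0 <= t -> pnorm p (C *m expmx (rc t *: A) *m b) <= K) ->
  0 < complex.Re s -> s%:M - A \in unitmx ->
  complex.Re s * pnorm p (C *m invmx (s%:M - A) *m b) <= K.
Proof.
(* The Cayley-Hamilton argument is for positive dimension; in dimension [0] the
   product vanishes. *)
case: n A C b => [|n] A C b CK s0 sA.
  rewrite [C]thinmx0 !mul0mx pnorm0// mulr0.
  exact: le_trans (pnorm_ge0 _ _) (CK 0 (lexx 0)).
pose u m := 1 - s * rc (h m).
pose E m := expmx (rc (h m) *: A).
pose F m := 1 - u m *: E m.
pose G m := (rc (h m))^-1 *: F m.
(* Chosen so that [normc (u m) ^+ 2 = 1 - 2 * (h m * w m)]. *)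
pose w m := complex.Re s - normc s ^+ 2 / 2 * h m.
have h0 m : 0 < h m by have /andP[] := h01 m.
have w_cvg : w m @[m --> \oo] --> complex.Re s.
  rewrite -[X in _ --> X]subr0 -(mulr0 (normc s ^+ 2 / 2)).
  apply: cvgB; first exact: cvg_cst.
  by apply: cvgM; [exact: cvg_cst|exact: h_cvg0].
have G_cvg i j : (G m i j : R[i]^o) @[m --> \oo] --> ((s%:M - A) i j : R[i]^o).
  exact: cvg_euler_quotient.
have rhs : complex.Re s * pnorm p (C *m invmx (s%:M - A) *m b)
    = pnorm p (rc (complex.Re s) *: (C *m invmx (s%:M - A) *m b)).
  by rewrite pnormZ// normc_real gtr0_norm.
rewrite rhs.
apply: (pnorm_le_cvg hp (x := fun m => rc (w m) *: (C *m invmx (G m) *m b))).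
  move=> k; rewrite mxE; under eq_cvg do rewrite mxE.
  apply: cvgM; first exact: cvg_real_complex.
  apply: (@cvg_mulmx R[i]) => i j; last exact: cvg_cst.
  apply: (@cvg_mulmx R[i]) => {}i {}j; first exact: cvg_cst.
  exact: (@cvg_invmx R[i]).
have w_gt0 : \forall m \near \oo, 0 < w m.
  exact: (cvgr_gt _ w_cvg).
have G_unit : \forall m \near \oo, G m \in unitmx.
  exact: (@near_unitmx R[i] _ _ _ _ _ _ sA).
near=> m.
have wm : 0 < w m by near: m.
have Gm : G m \in unitmx by near: m.
have z0 : rc (h m) != 0 by rewrite fmorph_eq0 lt0r_neq0.
have FG : F m = rc (h m) *: G m by rewrite /G scalerA mulfV// scale1r.
have Fm : F m \in unitmx by rewrite FG unitmxZ ?unitfE.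
have invG : invmx (G m) = rc (h m) *: invmx (F m).
  by rewrite /G invmxZ ?invrK.
have u2 : normc (u m) ^+ 2 = 1 - 2 * (h m * w m).
  rewrite /w !normc_sqrE /u; case: (s) => x y /=.
  by field.
have u_lt1 : normc (u m) < 1.
  rewrite -(@ltr_pXn2r _ 2) ?nnegrE ?normc_ge0// u2 expr1n.
  by rewrite gtrBl mulr_gt0// mulr_gt0.
(* [1 - v = (1 - v ^+ 2) / (1 + v)] for [v = normc (u m)], and [1 + v <= 2]. *)
have w_le : h m * w m <= 1 - normc (u m).
  have : 0 <= normc (u m) := normc_ge0 _.
  nra.
rewrite pnormZ// normc_real gtr0_norm// invG -scalemxAr -scalemxAl pnormZ//.
rewrite normc_real gtr0_norm// mulrA [w m * _]mulrC.
apply: le_trans (ler_wpM2r (pnorm_ge0 _ _) w_le) _.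
apply: discrete_resolvent_bound => // k.
by rewrite /E -expmx_natmul ?(ltW (h0 m))// CK// mulr_ge0// ltW.
Unshelve. all: by end_near. Qed.

End Resolvent.

(** * The transfer matrix as a matrix of rational functions *)

Lemma horner_char_poly_mx (K : comNzRingType) n (A : 'M[K]_n) (s : K) :
  map_mx (horner_eval s) (char_poly_mx A) = s%:M - A.
Proof.
apply/matrixP => k l.
by rewrite !mxE /horner_eval hornerD hornerN hornerMn hornerX hornerC.
Qed.

Lemma unitmx_char_poly (K : fieldType) n (A : 'M[K]_n) (s : K) :
  (s%:M - A \in unitmx) = ((char_poly A).[s] != 0).
Proof. by rewrite unitmxE unitfE -horner_char_poly_mx det_map_mx. Qed.

(** Cramer's rule writes the entries over the common denominator [char_poly A], and
    evaluation at [s] commutes with determinants and adjugates. *)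
Lemma transfer_mx_value (K : fieldType) (N P Q : nat)
    (A : 'M[K]_N) (B : 'M[K]_(N, P)) (C : 'M[K]_(Q, N)) (s : K) :
  s%:M - A \in unitmx ->
  mx_frac_value (transfer_mx A B C) s (C *m invmx (s%:M - A) *m B).
Proof.
move=> sA i j.
set X := char_poly_mx A.
have Xs : map_mx (horner_eval s) X = s%:M - A := horner_char_poly_mx A s.
have ds : (\det X).[s] != 0 by rewrite -unitmx_char_poly.
have unitX : map_mx (@tofrac {poly K}) X \in unitmx.
  by rewrite unitmxE det_map_mx unitfE tofrac_eq0; apply: contraNneq ds => ->; rewrite horner0.
pose num := map_mx polyC C *m \adj X *m map_mx polyC B.
exists (num i j), (\det X); split => //.
  rewrite /transfer_mx /invmx unitX det_map_mx -map_mx_adj.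
  rewrite -scalemxAr -scalemxAl mxE mulrC; congr (_ / _).
  rewrite (_ : map_mx (@fracC K) C = map_mx (@tofrac _) (map_mx polyC C)); last first.
    by apply/matrixP => k l; rewrite !mxE.
  rewrite (_ : map_mx (@fracC K) B = map_mx (@tofrac _) (map_mx polyC B)); last first.
    by apply/matrixP => k l; rewrite !mxE.
  by rewrite -!map_mxM mxE.
have -> : (num i j).[s] = (C *m \adj (s%:M - A) *m B) i j.
  rewrite -[LHS]/(horner_eval s (num i j)).
  transitivity (map_mx (horner_eval s) num i j); first by rewrite [RHS]mxE.
  rewrite !map_mxM map_mx_adj Xs; congr ((_ *m _ *m _) i j).
    by apply/matrixP => k l; rewrite !mxE /= /horner_eval hornerC.
  by apply/matrixP => k l; rewrite !mxE /= /horner_eval hornerC.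
rewrite /invmx sA -scalemxAr -scalemxAl mxE mulrC; congr (_ / _).
by rewrite -[RHS]/(horner_eval s _) -det_map_mx Xs.
Qed.

Lemma cvg_horner (K : numFieldType) (T : Type) (F : set_system T) {FF : Filter F}
    (s : K) (z : T -> K) (q : {poly K}) :
  z t @[t --> F] --> s -> q.[z t] @[t --> F] --> q.[s].
Proof.
move=> zs; elim/poly_ind : q => [|q c IH].
  by rewrite horner0; under eq_cvg do rewrite horner0; exact: cvg_cst.
rewrite hornerMXaddC; under eq_cvg do rewrite hornerMXaddC.
by apply: cvgD; [exact: cvgM|exact: cvg_cst].
Qed.

Section FracLimits.
Context {K : numFieldType} {T : Type} {F : set_system T} {FF : ProperFilter F}.
Variables (f : {fraction {poly K}}) (s : K) (z w : T -> K).
Hypothesis zs : z t @[t --> F] --> s.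
Hypothesis fzw : \forall t \near F, frac_value f (z t) (w t).

Lemma frac_value_cvg v : frac_value f s v -> w t @[t --> F] --> v.
Proof.
move=> [n [d [ds fE ->]]].
have lim : (n.[z t] / d.[z t]) @[t --> F] --> n.[s] / d.[s].
  by apply: cvgM; [exact: cvg_horner|apply: cvgV => //; exact: cvg_horner].
apply: cvg_trans lim; apply: near_eq_cvg.
have dz : \forall t \near F, d.[z t] != 0.
  by apply: (cvgr_neq0 d.[s]) => //; exact: cvg_horner.
move: fzw dz; apply: filterS2 => t fw dt.
by apply: frac_value_uniq fw; exists n, d.
Qed.

(** In lowest terms a vanishing denominator comes with a non-vanishing
    numerator, so that [f] would be unbounded near [s]. *)
Lemma frac_value_of_bounded c :
  (\forall t \near F, `|w t| <= c) -> exists v, frac_value f s v.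
Proof.
move=> wc.
have [n [d [d0 fE dn]]] : exists n d : {poly K},
    [/\ d != 0, f = tofrac n / tofrac d & coprimep d n].
  have /filter_ex[t [n [d [dt fE _]]]] := fzw.
  have d0 : d != 0 by apply: contraNneq dt => ->; rewrite horner0.
  have g0 : gcdp d n != 0 by rewrite gcdp_eq0 negb_and d0.
  exists (n %/ gcdp d n), (d %/ gcdp d n); split.
  - by rewrite dvdp_div_eq0 ?dvdp_gcdl.
  - rewrite fE -{1}(divpK (dvdp_gcdr d n)) -{3}(divpK (dvdp_gcdl d n)).
    by rewrite !tofracM -mulf_div divff ?mulr1// tofrac_eq0.
  - by rewrite coprimep_div_gcd// d0.
have [ds|ds] := eqVneq d.[s] 0; last by exists (n.[s] / d.[s]), n, d.
have ns : n.[s] != 0 by apply: (coprimep_root dn); exact/rootP.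
have nwd : \forall t \near F, n.[z t] = w t * d.[z t].
  apply: filterS fzw => t [n' [d' [dt fE' ->]]].
  have d'0 : d' != 0 by apply: contraNneq dt => ->; rewrite horner0.
  move: fE'; rewrite fE => /eqP; rewrite eqr_div ?tofrac_eq0//.
  rewrite -!tofracM tofrac_eq => /eqP/(congr1 (horner^~ (z t))).
  by rewrite /= !hornerM => e; rewrite mulrAC -e mulfK.
have n0 : n.[z t] @[t --> F] --> (0 : K).
  have d_cvg : d.[z t] @[t --> F] --> (0 : K) by rewrite -ds; exact: cvg_horner.
  apply/cvgr0Pnorm_le => e e0.
  have c0 : 0 < `|c| + 1 by rewrite ltr_wpDl.
  have /cvgr0Pnorm_le/(_ (e / (`|c| + 1))) := d_cvg.
  rewrite divr_gt0// => /(_ isT); move: nwd wc; apply: filterS3 => t -> wt dt.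
  rewrite normrM -(divfK (lt0r_neq0 c0) e) mulrC ler_pM//.
  rewrite (le_trans wt)// (le_trans (real_ler_norm _))// ?lerDl//.
  by rewrite (ger0_real (le_trans _ wt)).
case/negP: ns; apply/eqP; apply: (cvg_unique _ (cvg_horner (q := n) zs) n0).
exact: norm_hausdorff.
Qed.

End FracLimits.

(** Zeros are isolated: up to a power of ['X - s%:P], [q] does not vanish at [s]. *)
Lemma near_horner_neq0 (K : numFieldType) (T : Type) (F : set_system T) {FF : Filter F}
    (q : {poly K}) (s : K) (z : T -> K) :
  q != 0 -> z t @[t --> F] --> s -> (\forall t \near F, z t != s) ->
  \forall t \near F, q.[z t] != 0.
Proof.
move=> q0 zs zNs.
have [m [r]] := multiplicity_XsubC q s; rewrite q0 => rs ->.
have rz : \forall t \near F, r.[z t] != 0.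
  by apply: (cvgr_neq0 r.[s]) => //; exact: cvg_horner.
move: zNs rz; apply: filterS2 => t zt rt.
by rewrite hornerM horner_exp hornerXsubC mulf_neq0// expf_neq0// subr_eq0.
Qed.

(** * The bound on the open right half plane *)

(** Approaching [s] horizontally from the right only increases the real part, so the
    bound with [Re s] holds along the whole sequence, and it avoids eigenvalues of
    [A] eventually. *)
Lemma transfer_norm_bound (R : realType) (N P Q : nat)
    (A : 'M[R[i]]_N) (B : 'M[R[i]]_(N, P)) (C : 'M[R[i]]_(Q, N))
    (p : \bar R) (hp : (1 <= p)%E) (K : R) (s : R[i]) :
  (forall x, pnorm p x = 1 -> forall t, 0 <= t ->
     pnorm p (C *m expmx (rc t *: A) *m B *m x) <= K) ->
  0 <= K -> 0 < complex.Re s ->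
  ((complex.Re s)%:E * opnorm_at p (transfer_mx A B C) s <= K%:E)%E.
Proof.
move=> CK K0 s0.
pose z k := s + rc k.+1%:R^-1.
pose W k := C *m invmx ((z k)%:M - A) *m B.
have zs : (z k : R[i]^o) @[k --> \oo] --> (s : R[i]^o).
  rewrite -[X in _ --> X]addr0; apply: cvgD; first exact: cvg_cst.
  apply: (@cvg_real_complex _ (fun k => k.+1%:R^-1) 0); exact: cvg_harmonic.
have zA : \forall k \near \oo, (z k)%:M - A \in unitmx.
  under eq_near do rewrite unitmx_char_poly.
  apply: (@near_horner_neq0 R[i] _ _ _ _ s) => //.
    exact/monic_neq0/char_poly_monic.
  apply: nearW => k; rewrite -subr_eq0 addrAC subrr add0r fmorph_eq0.
  by rewrite invr_eq0 pnatr_eq0.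
have TW : \forall k \near \oo, mx_frac_value (transfer_mx A B C) (z k) (W k).
  by apply: filterS zA => k; exact: transfer_mx_value.
have Wx x : pnorm p x = 1 ->
    \forall k \near \oo, pnorm p (W k *m x) <= K / complex.Re s.
  move=> x1; apply: filterS zA => k zkA; rewrite ler_pdivlMr// mulrC.
  have sz : complex.Re s <= complex.Re (z k).
    by rewrite /z; case: (s) => a b /=; rewrite lerDl invr_ge0.
  apply: le_trans (ler_wpM2r (pnorm_ge0 _ _) sz) _.
  rewrite /W -mulmxA; apply: resolvent_bound => //; last exact: lt_le_trans sz.
  by move=> t t0; rewrite mulmxA CK.
have exM : exists M, mx_frac_value (transfer_mx A B C) s M.
  have ex i j : exists v, frac_value (transfer_mx A B C i j) s v.
    apply: (@frac_value_of_bounded R[i] _ _ _ _ s z (fun k => W k i j) zs _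
              (rc (K / complex.Re s))).
      by apply: filterS TW => k; exact.
    (* An entry is bounded by the norm of its column, the image of a unit vector. *)
    apply: filterS (Wx _ (pnorm_delta hp j)) => k.
    rewrite normc_normr lecR; apply: le_trans.
    rewrite -colE; have -> : W k i j = col j (W k) i 0 by rewrite [RHS]mxE.
    exact: normc_le_pnorm.
  exists (\matrix_(i, j) projT1 (cid (ex i j))) => i j.
  by rewrite mxE; exact: projT2 (cid (ex i j)).
rewrite /opnorm_at; case: pselect => // {}exM.
have := projT2 (cid exM); set M := projT1 _ => sM.
have -> : K%:E = ((complex.Re s)%:E * (K / complex.Re s)%:E)%E.
  by rewrite -EFinM mulrC divfK// lt0r_neq0.
apply: lee_wpmul2l; first by rewrite lee_fin ltW.
apply: ge_ereal_sup => _ [->|[x x1 <-]]; rewrite lee_fin ?divr_ge0 ?(ltW s0)//.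
apply: (pnorm_le_cvg hp (x := fun k => W k *m x)); last exact: Wx.
move=> i; apply: (@cvg_mulmx R[i]) => {}i j; last exact: cvg_cst.
apply: (@frac_value_cvg R[i] _ _ _ (transfer_mx A B C i j) s z) => //.
by apply: filterS TW => k; exact.
Qed.

Theorem theorem3 (R : realType) (N P Q : nat)
    (A : 'M[R[i]]_N) (B : 'M[R[i]]_(N, P)) (C : 'M[R[i]]_(Q, N))
    (p : \bar R) (hp : (1 <= p)%E) :
  (ereal_sup [set (complex.Re s)%:E * opnorm_at p (transfer_mx A B C) s
               | s in [set s : R[i] | (0 < complex.Re s)%R]]
   <= ereal_sup [set opnorm p (C *m expmx ((real_complex R t) *: A) *m B)
               | t in [set t : R | (0 <= t)%R]])%E.
Proof.
apply: ge_ereal_sup => _ [s s0 <-].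
set S := [set _ | t in _].
have normS t : 0 <= t ->
    (opnorm p (C *m expmx (real_complex R t *: A) *m B) <= ereal_sup S)%E.
  by move=> t0; apply: ereal_sup_ubound; exists t.
have S0 : (0 <= ereal_sup S)%E.
  by apply: le_trans (normS 0 (lexx 0)); apply: ereal_sup_ubound; left.
have xS x t : pnorm p x = 1 -> 0 <= t ->
    ((pnorm p (C *m expmx (real_complex R t *: A) *m B *m x))%:E <= ereal_sup S)%E.
  move=> x1 t0; apply: le_trans (normS t t0).
  by apply: ereal_sup_ubound; right; exists x.
move: S0 xS; case: (ereal_sup S) => [K||]//= S0 xS; last by rewrite leey.
by apply: transfer_norm_bound => // x x1 t t0; rewrite -lee_fin xS.
Qed.
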